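(* Let $\mathbb{A}$ be a non-empty set and $x\in\mathbb{A}^{\mathbb N}$. Let $\mathscr{F}(x)=\{A\subseteq\mathbb{A}^+: x\in A^{\mathbb N}\}$ and $\mathcal{U}(x)=\{p\in\beta\mathbb{A}^+: p\subseteq\mathscr{F}(x)\}$. Then the following are equivalent: (i) $x$ is periodic; (ii) $\mathcal{U}(x)$ is a closed sub-semigroup of $\beta\mathbb{A}^+$; (iii) $\mathcal{U}(x)$ contains an idempotent element; (iv) the set $\mathrm{Pref}(x)$ of all (non-empty) prefixes of $x$ is an IP-set in $\mathbb{A}^+$.
   Context: $\mathbb{A}^+$ is the free semigroup of non-empty finite words over $\mathbb{A}$ under concatenation, viewed as a discrete semigroup. For $A\subseteq\mathbb{A}^+$, $x\in A^{\mathbb N}$ means $x=u_1u_2u_3\cdots$ with each $u_i\in A$. $\beta\mathbb{A}^+$ is the set of ultrafilters on $\mathbb{A}^+$ with the topology generated by the sets $\overline{A}=\{p: A\in p\}$ and the semigroup operation $p\cdot q=\{A\subseteq\mathbb{A}^+: \{s\in\mathbb{A}^+: s^{-1}A\in q\}\in p\}$, where $s^{-1}A=\{t: st\in A\}$; this is the Stone–Čech compactification, a compact right topological semigroup. An idempotent is $p$ with $p\cdot p=p$. A subset $A\subseteq\mathbb{A}^+$ is an IP-set if there is a sequence $(s_n)_{n\in\mathbb N}$ in $\mathbb{A}^+$ such that $A$ contains all finite products $\prod_{n\in F}s_n$ (in increasing order of indices) for non-empty finite $F\subseteq\mathbb N$. An infinite word $x$ is periodic if $x=uuu\cdots$ for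 some $u\in\mathbb{A}^+$. *)

(* Defs.v *)
From HB Require Import structures.
From mathcomp Require Import all_boot.
From mathcomp Require Import boolp classical_sets functions filter.
From mathcomp Require Import topology.

Set Implicit Arguments.
Unset Strict Implicit.
Unset Printing Implicit Defensive.

Local Open Scope classical_set_scope.

(* The free semigroup of words over A. A non-empty word is given by its first
   letter and the (possibly empty) sequence of the remaining ones. *)
Record word (A : Type) := Word { whead : A; wtail : seq A }.

HB.instance Definition _ (A : Type) := gen_eqMixin (word A).
HB.instance Definition _ (A : Type) := gen_choiceMixin (word A).

Definition letters (A : Type) (w : word A) : seq A := whead w :: wtail w.

Definition wcat (A : Type) (v w : word A) : word A :=
  Word (whead v) (wtail v ++ letters w).

Lemma letters_wcat (A : Type) (v w : word A) :
  letters (wcat v w) = letters v ++ letters w.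
Proof. by []. Qed.

Lemma letters_inj (A : Type) : injective (@letters A).
Proof. by move=> [a s] [b t] [-> ->]. Qed.

Lemma wcatA (A : Type) : associative (@wcat A).
Proof. by move=> u v w; apply: letters_inj; rewrite !letters_wcat catA. Qed.

HB.instance Definition _ (A : Type) := isSemigroup.Build (word A) (@wcatA A).

(* The infinite word u_0 u_1 u_2 ... : its k-th letter already occurs in
   u_0 ... u_k, so the default value of nth is never used. *)
Definition infcat (A : Type) (u : nat -> word A) : nat -> A :=
  fun k => nth (whead (u 0)) (flatten (mkseq (fun i => letters (u i)) k.+1)) k.

Lemma size_flatten_words (A : Type) (u : nat -> word A) n :
  n <= size (flatten (mkseq (fun i => letters (u i)) n)).
Proof.
elim: n => // n IHn; rewrite mkseqS flatten_rcons size_cat /= addnS ltnS.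
exact: leq_trans IHn (leq_addr _ _).
Qed.

Lemma infcat_prefix (A : Type) (u : nat -> word A) n :
  let s := flatten (mkseq (fun i => letters (u i)) n) in
  mkseq (infcat u) (size s) = s.
Proof.
move=> s; apply: (@eq_from_nth _ (whead (u 0))); first by rewrite size_mkseq.
move=> k; rewrite size_mkseq => lt_ks; rewrite nth_mkseq // /infcat /s.
pose fl m := flatten (mkseq (fun i => letters (u i)) m).
have flD a b : exists t, fl (a + b) = fl a ++ t.
  rewrite /fl /mkseq iotaD map_cat flatten_cat; by eexists.
rewrite -!/(fl _) in lt_ks *.
have lt_kk : k < size (fl k.+1) by exact: size_flatten_words.
case: (leqP n k.+1) => [|/ltnW] /subnKC <-.
  by have [t ->] := flD n (k.+1 - n); rewrite nth_cat lt_ks.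
by have [t ->] := flD k.+1 (n - k.+1); rewrite nth_cat lt_kk.
Qed.

Definition factors_over (A : Type) (x : nat -> A) : set_system (word A) :=
  [set B | exists u : nat -> word A, (forall n, B (u n)) /\ x = infcat u].

Definition periodic_word (A : Type) (x : nat -> A) : Prop :=
  exists u : word A, x = infcat (fun _ => u).

Definition Pref (A : Type) (x : nat -> A) : set (word A) :=
  [set w | letters w = mkseq x (size (letters w))].

(* A non-empty finite F \subset nat is given by the strictly increasing list
   n0 :: ns of its elements. *)
Definition IP_set (S : semigroupType) (B : set S) : Prop :=
  exists s : nat -> S, forall (n0 : nat) (ns : seq nat), path ltn n0 ns ->
    B (foldl (fun t n => (t * s n)%g) (s n0) ns).

Record beta (S : Type) := Beta {
  ultra :> set_system S;
  ultraP : UltraFilter ultra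
}.

HB.instance Definition _ (S : Type) := gen_eqMixin (beta S).
HB.instance Definition _ (S : Type) := gen_choiceMixin (beta S).
HB.instance Definition _ (S : Type) :=
  isSubBaseTopological.Build (beta S) [set: set S]
    (fun B : set S => [set p : beta S | ultra p B]).

Lemma beta_inj (S : Type) : injective (@ultra S).
Proof. by move=> [p hp] [q hq] /= E; case: q / E hq => hq; congr Beta. Qed.

Section BetaMul.
Variable S : semigroupType.
Implicit Types p q r : beta S.

Definition lquot (s : S) (B : set S) : set S := [set t | B (s * t)%g].

Definition ultra_mul p q : set_system S :=
  [set B | ultra p [set s | ultra q (lquot s B)]].

Lemma ultra_mulP p q : UltraFilter (ultra_mul p q).
Proof.
have pU := ultraP p; have qU := ultraP q.
have mulE B : ultra_mul p q B = ultra p [set s | ultra q (lquot s B)] by [].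
have FF : Filter (ultra_mul p q).
  split=> [|B C|B C sBC]; rewrite !mulE.
  - by apply: (@filterS _ (ultra p)) filterT => s _; exact: filterT.
  - by apply: filterS2 => s; exact: filterI.
  - by apply: filterS => s; apply: filterS => t; exact: sBC.
have PF : ProperFilter (ultra_mul p q).
  apply: Build_ProperFilter_ex => B; rewrite mulE => /filter_ex[s hs].
  by have [t ht] := filter_ex hs; exists (s * t)%g.
split=> // G GF sG; rewrite eqEsubset; split=> // B GB.
have [//|pn] := in_ultra_setVsetC [set s | ultra q (lquot s B)] pU.
suff /sG GnB : ultra_mul p q (~` B).
  by have [t []] := filter_ex (filterI GB GnB).
apply: filterS pn => s /= qn.
by have [|] := in_ultra_setVsetC (lquot s B) qU.
Qed.

Definition beta_mul p q : beta S := Beta (ultra_mulP p q).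

Lemma beta_mulA : associative beta_mul.
Proof.
move=> p q r; apply: beta_inj; apply/funext => B.
congr (ultra p _); apply/funext => s; congr (ultra q _); apply/funext => t.
by congr (ultra r _); apply/funext => u; rewrite /lquot /= mulgA.
Qed.

End BetaMul.

HB.instance Definition _ (S : semigroupType) :=
  isSemigroup.Build (beta S) (@beta_mulA S).

(* Semigroups, hence sub-semigroups, are non-empty. *)
Definition sub_semigroup (S : semigroupType) (V : set S) : Prop :=
  V !=set0 /\ forall p q, V p -> V q -> V (p * q)%g.

Definition U_ (A : Type) (x : nat -> A) : set (beta (word A)) :=
  [set p | ultra p `<=` factors_over x].

(* Main.v *)
Require Import Defs.
From HB Require Import structures.
From mathcomp Require Import all_boot finmap.
From mathcomp Require Import boolp classical_sets functions filter.
From mathcomp Require Import topology.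

Set Implicit Arguments.
Unset Strict Implicit.
Unset Printing Implicit Defensive.

Local Open Scope classical_set_scope.

(* If x = u u u ..., the ultrafilters of U(x) are exactly those containing the
   set of the words w with x = w w w ..., which is a sub-semigroup; so U(x) is a
   closed sub-semigroup. The Ellis-Numakura theorem then gives an idempotent p,
   and Pref(x) belongs to p because a factorization of x starts with a prefix of
   x, so Galvin's argument makes Pref(x) an IP-set. If finally s_0, s_1, ...
   witness this, then s_0 s_1 ... s_n and s_1 ... s_n are both prefixes of x for
   all n, whence x = s_0 x. *)

(** * Infinite products of words and their periods *)

Section InfiniteWords.
Variable A : Type.
Implicit Types (x : nat -> A) (u : nat -> word A) (v w : word A).

Lemma nth_infcat u n k d :
  k < size (flatten (mkseq (fun i => letters (u i)) n)) ->
  infcat u k = nth d (flatten (mkseq (fun i => letters (u i)) n)) k.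
Proof. by move=> ltk; rewrite -[in RHS]infcat_prefix nth_mkseq. Qed.

Lemma flatten_mkseqS u n :
  flatten (mkseq (fun i => letters (u i)) n.+1) =
  letters (u 0) ++ flatten (mkseq (fun i => letters (u i.+1)) n).
Proof. by rewrite /mkseq /= (iotaDl 1 0) -map_comp. Qed.

Lemma infcatD u k :
  infcat u (size (letters (u 0)) + k) = infcat (fun i => u i.+1) k.
Proof.
have ltk := size_flatten_words (fun i => u i.+1) k.+1.
(* The k+2 factors are [u 0] and k+1 further non-empty words, enough to reach this position. *)
rewrite (@nth_infcat u k.+2 _ (whead (u 0))) flatten_mkseqS.
  by rewrite nth_cat ltnNge leq_addr addKn; exact/esym/nth_infcat.
by rewrite size_cat ltn_add2l.
Qed.

Lemma Pref_infcat u : Pref (infcat u) (u 0).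
Proof.
have := infcat_prefix u 1.
by rewrite (flatten_mkseqS u 0) /mkseq [flatten _]/= cats0 => /esym.
Qed.

Lemma eq_periodic x y n : 0 < n ->
  (forall k, x (n + k) = x k) -> (forall k, y (n + k) = y k) ->
  mkseq x n = mkseq y n -> x = y.
Proof.
move=> n0 xn yn exy; apply/funext => k.
elim/ltn_ind: k => k IHk; have [ltkn|lenk] := ltnP k n.
  by rewrite -(nth_mkseq (x 0) x ltkn) exy nth_mkseq.
by rewrite -(subnKC lenk) xn yn IHk // ltn_subrL n0 (leq_trans n0).
Qed.

(** A sequence of period n is determined by its first n letters, so the two conditions on the right
    fix x. *)
Lemma infcat_constP x w : x = infcat (fun=> w) <->
  Pref x w /\ forall k, x (size (letters w) + k) = x k.
Proof.
split=> [->|[xw xD]].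
  by split=> [|k]; [exact: Pref_infcat|exact: infcatD].
apply: (@eq_periodic _ _ (size (letters w))) => // [k|].
  exact: (infcatD (fun=> w)).
by rewrite -(Pref_infcat (fun=> w)) -xw.
Qed.

Lemma Pref_nth x w k d : Pref x w -> k < size (letters w) ->
  nth d (letters w) k = x k.
Proof. by move=> -> lt_kw; rewrite nth_mkseq // -[size _](size_mkseq x). Qed.

Lemma Pref_size_inj x v w : Pref x v -> Pref x w ->
  size (letters v) = size (letters w) -> v = w.
Proof. by move=> xv xw svw; apply: letters_inj; rewrite xv svw -xw. Qed.

Definition periods x : set (word A) := [set w | x = infcat (fun=> w)].

Lemma mkseqD x m n :
  mkseq x (m + n) = mkseq x m ++ mkseq (fun k => x (m + k)) n.
Proof.
by rewrite /mkseq iotaD map_cat add0n -[in iota m n](addn0 m) iotaDl -map_comp.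
Qed.

Lemma periodsM x v w : periods x v -> periods x w -> periods x (v * w)%g.
Proof.
move=> /infcat_constP[xv xvD] /infcat_constP[xw xwD]; apply/infcat_constP.
have lvw : letters (v * w)%g = letters v ++ letters w by [].
split=> [|k]; last by rewrite lvw size_cat -addnA xvD xwD.
change (letters v ++ letters w = mkseq x (size (letters v ++ letters w))).
by rewrite size_cat mkseqD -xv (eq_mkseq xvD) -xw.
Qed.

End InfiniteWords.

(** * Topology of the space of ultrafilters *)

Section BetaTopology.
Variable S : Type.
Implicit Types (p : beta S) (B : set S) (V : set (beta S)).

Lemma ultraC p B : ~ ultra p B -> ultra p (~` B).
Proof. by have pU := ultraP p; have [] := in_ultra_setVsetC B pU. Qed.

(** The subbasic sets form a base, since an ultrafilter contains a finite intersection as soon as it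
    contains each term. *)
Lemma nbhs_beta p (N : set (beta S)) : nbhs p N <->
  exists2 B, ultra p B & [set q : beta S | ultra q B] `<=` N.
Proof.
split=> [|[B pB sBN]]; rewrite nbhsE; last first.
  exists [set q : beta S | ultra q B] => //; split=> //.
  exists [set [set q : beta S | ultra q B]]; last by rewrite bigcup_set1.
  by move=> _ ->; exact: finI_from1.
move=> [_ [[D sD <-] [J DJ]]] Jp sDN.
have [E JE] : exists E : {fset set S},
    \bigcap_(B in [set` E]) [set q : beta S | ultra q B] = J.
  by have [E _ JE] := sD _ DJ; exists E.
have pE : (\bigcap_(B in [set` E]) [set q : beta S | ultra q B]) p.
  by rewrite JE.
have pU := ultraP p; exists (\bigcap_(B in [set` E]) B); first exact: filter_bigI.
move=> q qE; apply: sDN; exists J => //.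
suff : (\bigcap_(B in [set` E]) [set q : beta S | ultra q B]) q by rewrite JE.
by move=> B BE; have qU := ultraP q; apply: filterS qE => s; exact.
Qed.

Lemma closed_ultra B : closed [set p : beta S | ultra p B].
Proof.
move=> p clp /=; apply: contrapT => /ultraC pnB.
have [|q []] := clp [set q | ultra q (~` B)].
  by apply/nbhs_beta; exists (~` B).
move=> qB qnB; have qU := ultraP q.
by have [s []] := filter_ex (filterI qB qnB).
Qed.

(** Otherwise some B in p lies in no element of V; its complement is then common to all of V, hence
    in p. So a closed set is recovered from the filter of its common members. *)
Lemma closed_ultraI V p : closed V ->
  (forall B, (forall q, V q -> ultra q B) -> ultra p B) -> V p.
Proof.
move=> clV sVp; apply: clV => N /nbhs_beta[B pB sBN].
apply: contrapT => VN0; have pU := ultraP p.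
have /sVp pnB : forall q, V q -> ultra q (~` B).
  by move=> q Vq; apply: ultraC => qB; apply: VN0; exists q; split=> //; exact: sBN.
by have [s []] := filter_ex (filterI pB pnB).
Qed.

Lemma ultra_sub_eq p q : ultra p `<=` ultra q -> p = q.
Proof.
move=> spq; apply: beta_inj; have pU := ultraP p.
by rewrite (max_filter _ spq) //; have [] := ultraP q.
Qed.

Lemma ultra_ext (F : set_system S) : ProperFilter F ->
  exists p : beta S, F `<=` ultra p.
Proof. by move=> /ultraFilterLemma[P [PU sFP]]; exists (Beta PU). Qed.

End BetaTopology.

(** * Idempotents in closed sub-semigroups *)

Section Idempotents.
Variable S : semigroupType.
Implicit Types (F G : set_system S) (p q r : beta S) (V : set (beta S)).

(** If a filter F stands for the closed set K of the ultrafilters finer than F, this filter stands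
    for K q. *)
Definition filter_mul F q : set_system S :=
  [set B | F [set s | ultra q (lquot s B)]].

Lemma filter_mul_proper F q : ProperFilter F -> ProperFilter (filter_mul F q).
Proof.
move=> FF; have qU := ultraP q; apply: Build_ProperFilter_ex.
  move=> B; rewrite /filter_mul /= => FB; have [s qB] := filter_ex FB.
  by have [t Bt] := filter_ex qB; exists (s * t)%g.
split=> [|B C|B C sBC]; rewrite /filter_mul /=.
- by apply: filterS filterT => s _; exact: filterT.
- by apply: filterS2 => s; exact: filterI.
- by apply: filterS => s; apply: filterS => t; exact: sBC.
Qed.

(* Its finer ultrafilters are the p finer than F such that p q = r. *)
Definition quotient_filter F q r : set_system S :=
  [set C | exists B0 B, [/\ F B0, ultra r B &
    B0 `&` [set s | ultra q (lquot s B)] `<=` C]].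

Lemma sub_quotient_filter F q r : F `<=` quotient_filter F q r.
Proof.
move=> B FB; have rU := ultraP r.
by exists B, setT; split=> [||s []] //; exact: filterT.
Qed.

Lemma quotient_filter_lquot F q r B : ProperFilter F -> ultra r B ->
  quotient_filter F q r [set s | ultra q (lquot s B)].
Proof.
by move=> FF rB; exists setT, B; split=> [||s []] //; exact: filterT.
Qed.

(** If B0 missed the set of all s with [lquot s B] in q, the complement of B would lie in
    [filter_mul F q], hence in r. *)
Lemma quotient_filter_proper F q r : ProperFilter F ->
  filter_mul F q `<=` ultra r -> ProperFilter (quotient_filter F q r).
Proof.
move=> FF sFr; have qU := ultraP q; have rU := ultraP r.
apply: Build_ProperFilter_ex => [C [B0 [B [FB0 rB sC]]]|].
  apply: contrapT => C0.
  have /sFr rnB : filter_mul F q (~` B).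
    apply: filterS FB0 => s B0s; apply: ultraC => qB.
    by apply: C0; exists s; apply: sC.
  by have [s []] := filter_ex (filterI rB rnB).
split=> [|C C' [B0 [B [FB0 rB sC]]] [B0' [B' [FB0' rB' sC']]]|].
- exact: sub_quotient_filter filterT.
- exists (B0 `&` B0'), (B `&` B'); split; [exact: filterI|exact: filterI|].
  move=> s [[B0s B0s'] qs]; split; [apply: sC|apply: sC']; split=> //.
    by apply: filterS qs => t [].
  by apply: filterS qs => t [].
- move=> C C' sCC' [B0 [B [FB0 rB sC]]].
  by exists B0, B; split=> //; exact: subset_trans sCC'.
Qed.

(** Any ultrafilter p finer than [quotient_filter F q r] works: r is contained in p q, hence equal
    to it. *)
Lemma ultra_filter_mul F q r : ProperFilter F ->
  filter_mul F q `<=` ultra r ->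
  exists2 p, F `<=` ultra p & (p * q)%g = r.
Proof.
move=> FF sFr; have [p sHp] := ultra_ext (quotient_filter_proper FF sFr).
exists p; first exact: subset_trans (@sub_quotient_filter F q r) sHp.
apply/esym/ultra_sub_eq => B rB; apply: sHp.
exact: quotient_filter_lquot.
Qed.

(* F is additive when the closed set of the ultrafilters finer than F is a
   sub-semigroup of beta S. *)
Definition additive_filter F :=
  ProperFilter F /\ forall q, F `<=` ultra q -> F `<=` filter_mul F q.

(** By Zorn's lemma: an ultrafilter finer than the union of a chain is finer than each member, so
    additivity passes to the union. *)
Lemma additive_filter_max F : additive_filter F ->
  exists G, [/\ additive_filter G, F `<=` G &
    forall H, additive_filter H -> G `<=` H -> H `<=` G].
Proof.
(* [F `|` G] instead of [G], so that P holds for the empty chain. *)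
move=> aF; pose P := [set G | additive_filter (F `|` G)].
have [|G [PG maxG]] := @Zorn_bigcup _ P; last first.
  exists (F `|` G); split=> // H aH sH; apply: contrapT => nHG.
  have FH : F `|` H = H by apply/setUidPr => B FB; apply: sH; left.
  apply: (maxG H); last by rewrite /P /= FH.
  split=> [B GB|sHG]; first by apply: sH; right.
  by apply: nHG => B /sHG; right.
move=> C CP totC; have [[G0 CG0]|C0] := pselect (C !=set0); last first.
  rewrite /P /= (_ : \bigcup_(X in C) X = set0) ?setU0 //.
  by rewrite -subset0 => B [X CX _]; apply: C0; exists X.
pose K := F `|` \bigcup_(X in C) X.
have KE B : K B <-> exists2 X, C X & (F `|` X) B.
  split=> [[FB|[X CX XB]]|[X CX [FB|XB]]].
  - by exists G0 => //; left.
  - by exists X => //; right.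
  - by left.
  - by right; exists X.
split=> [|q sKq B /KE[X CX XB]]; last first.
  have [XF sX] := CP _ CX.
  have: filter_mul (F `|` X) q B by apply: sX => // D XD; apply/sKq/KE; exists X.
  by move=> /= ?; apply/KE; exists X.
apply: Build_ProperFilter_ex.
  by move=> B /KE[X /CP[XF _] /filter_ex].
split=> [|B D /KE[X CX XB] /KE[Y CY YD]|B D sBD /KE[X CX XB]]; apply/KE.
- by exists G0 => //; have [? _] := CP _ CG0; exact: filterT.
- have [XF _] := CP _ CX; have [YF _] := CP _ CY.
  have [sXY|sYX] := totC _ _ CX CY.
    by exists Y => //; apply: filterI => //; case: XB; [left|right; exact: sXY].
  by exists X => //; apply: filterI => //; case: YD; [left|right; exact: sYX].
- by exists X => //; have [? _] := CP _ CX; exact: filterS XB.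
Qed.

Lemma lquotM (s t : S) B : lquot t (lquot s B) = lquot (s * t)%g B.
Proof. by apply/funext => u; rewrite /lquot /= mulgA. Qed.

(* The Ellis-Numakura argument, read on filters: a maximal additive filter F
   stands for a minimal closed sub-semigroup K, and for q in K both
   K q and {r in K | r q = q} are again closed sub-semigroups of K. *)
Lemma idempotent_additive F : additive_filter F ->
  exists2 p, F `<=` ultra p & (p * p)%g = p.
Proof.
move=> /additive_filter_max[{}G [[GF aG] sFG maxG]].
have [q sGq] := ultra_ext GF; exists q; first exact: subset_trans sGq.
have ultraM p r B :
  ultra (p * r)%g B = ultra p [set s | ultra r (lquot s B)] by [].
have lquotE p s B : lquot s [set t | ultra p (lquot t B)] =
    [set t | ultra p (lquot t (lquot s B))].
  by apply/funext => t /=; rewrite lquotM.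
(* In terms of K this says that K is contained in K q. The left side is additive because K q p lies
   in K for p in K, so K q (p q) lies in K q. *)
have Gq : filter_mul G q `<=` G.
  apply: maxG; last exact: aG.
  split=> [|r sr B GB]; first exact: filter_mul_proper.
  have [p sGp <-] := ultra_filter_mul GF sr.
  rewrite {1}/filter_mul /= (_ : [set s | _] =
    [set s | ultra p (lquot s [set t | ultra q (lquot t B)])]).
    by apply: (aG q) => //; exact: (aG p).
  by apply/funext => s /=; rewrite lquotE.
have sGqq := subset_trans Gq sGq.
(* By maximality every r in K satisfies r q = q; the conclusion takes r = q. *)
have HG : quotient_filter G q q `<=` G.
  apply: maxG; last exact: sub_quotient_filter.
  have HF := quotient_filter_proper GF sGqq.
  split=> // p sHp C [B0 [B [GB0 qB sC]]].
  have sGp := subset_trans (@sub_quotient_filter G q q) sHp.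
  have pq : (p * q)%g = q.
    by apply/esym/ultra_sub_eq => D qD; apply: sHp; exact: quotient_filter_lquot.
  have pF := filter_mul_proper p HF; apply: filterS sC _; apply: filterI.
    exact: (@sub_quotient_filter G q q _ (aG _ sGp _ GB0)).
  rewrite /filter_mul /=.
  under eq_set do rewrite lquotE -ultraM pq.
  exact: quotient_filter_lquot.
apply/esym/ultra_sub_eq => B qB; apply/sGq/HG.
exact: quotient_filter_lquot.
Qed.

(** As V is closed, its elements are exactly the ultrafilters finer than the filter of their common
    members, which is therefore additive. *)
Lemma ellis_numakura V : closed V -> sub_semigroup V ->
  exists p, V p /\ (p * p)%g = p.
Proof.
move=> clV [[p0 Vp0] VM].
pose F : set_system S := [set B | forall p, V p -> ultra p B].
have [|p sFp pp] := @idempotent_additive F; last first.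
  by exists p; split=> //; apply: closed_ultraI => // B; exact: sFp.
split=> [|q sFq B FB p Vp]; last exact: FB (VM _ _ Vp (closed_ultraI clV sFq)).
apply: Build_ProperFilter_ex => [B FB|].
  by have pU := ultraP p0; exact: filter_ex (FB _ Vp0).
split=> [p _|B C FB FC p Vp|B C sBC FB p Vp]; have pU := ultraP p.
- exact: filterT.
- by apply: filterI; [exact: FB|exact: FC].
- exact: filterS sBC (FB _ Vp).
Qed.

End Idempotents.

(** * Members of idempotent ultrafilters are IP-sets *)

Section Galvin.
Variable S : semigroupType.

(** The products in [IP_set] are nested to the left, while the arguments below split off the first
    factor. *)
Lemma foldl_mulg (s : nat -> S) (a b : S) ns :
  foldl (fun t n => (t * s n)%g) (a * b)%g ns =
  (a * foldl (fun t n => (t * s n)%g) b ns)%g.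
Proof. by elim: ns b => //= n ns IHns b; rewrite -mulgA IHns. Qed.

Lemma idempotent_IP (p : beta S) (B : set S) :
  (p * p)%g = p -> ultra p B -> IP_set B.
Proof.
move=> pp pB; have pU := ultraP p.
have /choice[g gP] : forall C : set S, exists s : S,
    ultra p C -> C s /\ ultra p (lquot s C).
  move=> C; have [pC|?] := pselect (ultra p C).
    have ppC : ultra p [set s | ultra p (lquot s C)] by move: pC; rewrite -{1}pp.
    by have [s [Cs ps]] := filter_ex (filterI pC ppC); exists s.
  by have [s _] := filter_ex pB; exists s.
(* A product with least index n0 will lie in [C n0]: the product of its other factors lies in
   [C n0.+1], and [g (C n0)] multiplies that set into [C n0]. *)
pose C n := iter n (fun C : set S => C `&` lquot (g C) C) B.
have pC n : ultra p (C n).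
  by elim: n => //= n /[dup] pCn /gP[_ ?]; exact: filterI.
have sC m n : m <= n -> C n `<=` C m.
  move=> /subnKC <-; elim: (n - m) => [|k IHk]; rewrite ?addn0 // addnS.
  by move=> s [/IHk].
exists (fun n => g (C n)) => n0 ns nsP; apply: (sC 0 n0) => //.
elim: ns n0 nsP => [|n ns IHns] n0 /=; first by have [] := gP _ (pC n0).
move=> /andP[lt_n0n /IHns Cn]; rewrite foldl_mulg.
by have [_] := sC _ _ lt_n0n _ Cn.
Qed.

End Galvin.

(** * The implications between the four conditions *)

Section Periodicity.
Variables (A : Type) (x : nat -> A).
Implicit Types (p : beta (word A)) (w : word A).

Lemma ultra_Pref p : U_ x p -> ultra p (Pref x).
Proof.
move=> Up; apply: contrapT => /ultraC /Up[u [nPu xu]].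
by apply: (nPu 0); rewrite {1}xu; exact: Pref_infcat.
Qed.

(** Each member of p contains some w in [periods x], which gives a constant factorization. *)
Lemma U_periods p : ultra p (periods x) -> U_ x p.
Proof.
move=> pP B pB; have pU := ultraP p.
by have [w [xw Bw]] := filter_ex (filterI pP pB); exists (fun=> w).
Qed.

(** Only finitely many lengths are below N, and an ultrafilter selects one of them. *)
Lemma ultra_bounded_size p (B : set (word A)) N :
  ultra p (B `&` [set w | size (letters w) < N]) ->
  exists n, ultra p (B `&` [set w | size (letters w) = n]).
Proof.
have pU := ultraP p; elim: N => [|N IHN] pB.
  by have [w []] := filter_ex pB.
have [pN|/ultraC pnN] := pselect (ultra p [set w | size (letters w) = N]).
  by exists N; apply: filterS2 pB pN => w [].
apply: IHN; apply: filterS2 pB pnN => w [Bw] /=.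
by rewrite ltnS leq_eqVlt => /orP[/eqP|].
Qed.

(* Let N be a period of x. In a factorization x = v1 v2 ... into prefixes with
   |v2| >= N, the length of v1 is a period. If p contains the prefixes of length
   less than N, which are finitely many, it is principal. *)
Lemma periods_U p : periodic_word x -> U_ x p -> ultra p (periods x).
Proof.
move=> [w0 /infcat_constP[_ xD]] Up; have pU := ultraP p.
pose N := size (letters w0).
have pPref := ultra_Pref Up.
have [pN|/ultraC pnN] :=
    pselect (ultra p [set w | size (letters w) < N]).
  have [n /[dup] pn /Up[u [uP xu]]] := ultra_bounded_size (filterI pPref pN).
  (* Prefixes of equal length coincide, so u is constant. *)
  have xu0 : periods x (u 0).
    rewrite /periods /= {1}xu; congr infcat; apply/funext => i.
    have [ui si] := uP i; have [u0 s0] := uP 0.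
    by apply: (Pref_size_inj ui u0); rewrite si s0.
  apply: filterS pn => w [xw sw]; have [u0 s0] := uP 0.
  by rewrite (Pref_size_inj xw u0) // sw s0.
apply: contrapT => /ultraC pnP.
have [u [uP xu]] := Up _ (filterI pnN (filterI pPref pnP)).
have [_ [u0 nu0]] := uP 0; have [/negP + [u1 _]] := uP 1.
rewrite -leqNgt => leN.
apply: nu0; apply/infcat_constP; split=> // k.
have xS j : x (size (letters (u 0)) + j) = infcat (fun i => u i.+1) j.
  by rewrite {1}xu infcatD.
(* Both sequences have period N, and [u 1], of length at least N, is a prefix of both. *)
rewrite xS; congr (_ k); apply: (@eq_periodic _ _ _ N) => // [j|].
  by rewrite -!xS addnCA xD.
apply/eq_in_map => j; rewrite mem_iota => /andP[_ ltjN].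
have ltj := leq_trans ltjN leN.
rewrite -(Pref_nth (whead (u 1)) u1 ltj).
by rewrite -(Pref_nth (whead (u 1)) (Pref_infcat (fun i => u i.+1)) ltj).
Qed.

Lemma U_closed_semigroup :
  periodic_word x -> closed (U_ x) /\ sub_semigroup (U_ x).
Proof.
move=> xP; have UE : U_ x = [set p : beta (word A) | ultra p (periods x)].
  by rewrite eqEsubset; split=> p; [exact: periods_U|exact: U_periods].
rewrite UE; split; first exact: closed_ultra.
split=> [|p q pP qP].
  have [w xw] := xP; exists (Beta (principal_filter_ultra w)).
  exact/principal_filterP.
have pU := ultraP p; have qU := ultraP q.
apply: filterS pP => s sP; apply: filterS qP => t tP.
exact: periodsM.
Qed.

Lemma letters_foldl (s : nat -> word A) (a : word A) ns :
  letters (foldl (fun t n => (t * s n)%g) a ns) =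
  letters a ++ flatten [seq letters (s n) | n <- ns].
Proof.
elim: ns a => [|n ns IHns] a; first by rewrite cats0.
by rewrite [foldl _ _ _]/= IHns /= -catA.
Qed.

Lemma periodic_IP : IP_set (Pref x) -> periodic_word x.
Proof.
move=> [s sP]; exists (s 0); apply/infcat_constP.
split; first exact: (sP 0 [::]).
(* The word w below is the product of [s 1], ..., [s k.+1]: k+1 non-empty factors, so it has a
   letter of index k. *)
move=> k; pose ns := iota 2 k; pose d := whead (s 0).
have sorted_ns n0 m n : n0 < m -> path ltn n0 (iota m n).
  by elim: n n0 m => //= n IHn n0 m ->; exact: IHn.
pose w := foldl (fun t n => (t * s n)%g) (s 1) ns.
have xw : Pref x w by exact/sP/sorted_ns.
have xsw : Pref x (s 0 * w)%g.
  by rewrite -foldl_mulg; apply: (sP 0 (1 :: ns)); rewrite /= sorted_ns.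
have ltk : k < size (letters w).
  rewrite letters_foldl size_cat.
  rewrite /ns (iotaDl 2 0) -map_comp -addn1 addnC leq_add //.
  exact: (size_flatten_words (fun i => s i.+2)).
have lsw : letters (s 0 * w)%g = letters (s 0) ++ letters w by [].
rewrite -(Pref_nth d xw ltk) -(Pref_nth d xsw); last first.
  by rewrite lsw size_cat ltn_add2l.
by rewrite lsw nth_cat ltnNge leq_addr addKn.
Qed.

End Periodicity.

Theorem theorem3 (A : Type) (A_nonempty : inhabited A) (x : nat -> A) :
  [<-> periodic_word x;
       closed (U_ x) /\ sub_semigroup (U_ x);
       exists p : beta (word A), U_ x p /\ (p * p)%g = p;
       IP_set (Pref x)].
Proof.
split; first exact: U_closed_semigroup.
split; first by move=> [clU sU]; exact: ellis_numakura.
split; last exact: periodic_IP.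
by move=> [p [Up pp]]; exact: idempotent_IP pp (ultra_Pref Up).
Qed.
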